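(* Let $P,Q\subseteq\{2,4,5\}$ and $N\subseteq\{F,C,A1,A2\}$, and suppose that at least one of the following holds: (a) $\{A1,A2\}\subseteq N$; (b) $A1\notin N$ and $A2\notin N$; (c) $F\in N$ and moreover either $5\in P$, or $4\in Q$, or $5\notin Q$. Let $T=T_{P,Q,N}$ be the theory, in the language with two binary relation symbols $\leq$ and $\ll$, asserting that $\leq$ and $\ll$ are transitive, that $\leq$ satisfies the properties listed in $P$, that $\ll$ satisfies the properties listed in $Q$, and that the conditions listed in $N$ hold. Then $T$ has the superamalgamation property with respect to $\leq$. Moreover, the class of finite models of $T$ has a Fraïssé limit $\mathbf M$, and the first-order theory of $\mathbf M$ is $\omega$-categorical, has quantifier elimination, and is the model completion of $T$.
   Context: Properties of a binary relation $R$: property 2 means $R$ is reflexive; property 4 means $R$ is antireflexive; property 5 means $R$ is antisymmetric. Conditions in $N$: $F$ means $\ll$ is finer than $\leq$ (i.e. $x\ll y\Rightarrow x\leq y$); $C$ means $\ll$ is coarser than $\leq$ (i.e. $x\leq y\Rightarrow x\ll y$); $A1$ means that for all $w,x,y$, $w\leq x\ll y$ implies $w\ll y$; $A2$ means that for all $x,y,z$, $x\ll y\leq z$ implies $x\ll z$. For degenerate combinations (e.g. both 2 and 4 in $P$) empty structures are allowed. Superamalgamation property with respect to $\leq$: for all models $\mathbf A,\mathbf B,\mathbf C$ and embeddings $\iota_1:\mathbf C\to\mathbf A$, $\kappa_1:\mathbf C\to\mathbf B$ there are a model $\mathbf D$ and embeddings $\iota:\mathbf A\to\mathbf D$, $\kappa:\mathbf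 B\to\mathbf D$ with $\iota\circ\iota_1=\kappa\circ\kappa_1$, $\iota(A)\cap\kappa(B)=\iota(\iota_1(C))$, and such that for all $a\in A\setminus\iota_1(C)$, $b\in B\setminus\kappa_1(C)$: if $\iota(a)\leq^{\mathbf D}\kappa(b)$ then some $c\in C$ has $a\leq^{\mathbf A}\iota_1(c)$ and $\kappa_1(c)\leq^{\mathbf B} b$; and if $\kappa(b)\leq^{\mathbf D}\iota(a)$ then some $c\in C$ has $b\leq^{\mathbf B}\kappa_1(c)$ and $\iota_1(c)\leq^{\mathbf A} a$. *)

(* Defs.v *)
From mathcomp Require Import all_boot.
From mathcomp Require Import boolp classical_sets functions cardinality.

Set Implicit Arguments.
Unset Strict Implicit.
Unset Printing Implicit Defensive.

Local Open Scope classical_set_scope.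

(* Leq is the symbol <=, Ll is the symbol <<. *)
Inductive symbol := Leq | Ll.

(* The carrier may be empty. *)
Record structure := Structure {
  carrier :> Type;
  interp : symbol -> carrier -> carrier -> Prop
}.

Definition sle (A : structure) : A -> A -> Prop := interp Leq.
Definition sll (A : structure) : A -> A -> Prop := interp Ll.

Definition finite_structure (A : structure) : Prop := finite_set [set: A].
Definition countable_structure (A : structure) : Prop := countable [set: A].

Definition embedding (A B : structure) (f : A -> B) : Prop :=
  injective f /\
  forall (s : symbol) (x y : A), interp s x y <-> interp s (f x) (f y).

Definition isomorphism (A B : structure) (f : A -> B) : Prop :=
  embedding f /\ bijective f.

Definition isomorphic (A B : structure) : Prop :=
  exists f : A -> B, isomorphism f.

(* The language is relational, so every subset carries a substructure and
   the finitely generated substructures are the finite ones. *)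
Definition substructure (A : structure) (S : set A) : structure :=
  @Structure {x : A | S x} (fun s x y => interp s (sval x) (sval y)).

(* First-order formulas with equality whose free variables are the de Bruijn
   indices 0, ..., n-1; well-scopedness lets them be evaluated in an empty
   structure.  The other connectives and the existential quantifier are
   classically definable. *)
Inductive formula : nat -> Type :=
| Fbot n : formula n
| Feq n : 'I_n -> 'I_n -> formula n
| Frel n : symbol -> 'I_n -> 'I_n -> formula n
| Fimp n : formula n -> formula n -> formula n
| Fall n : formula n.+1 -> formula n.

Arguments Fbot {n}.

Definition sentence := formula 0.

Definition extend (A : Type) (n : nat) (x : A) (v : 'I_n -> A) (i : 'I_n.+1) : A :=
  match i with
  | Ordinal m lt_m =>
      match m return m < n.+1 -> A with
      | 0 => fun _ => x
      | k.+1 => fun lt_k => v (@Ordinal n k lt_k)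
      end lt_m
  end.

Fixpoint sat (A : structure) (n : nat) (phi : formula n) : ('I_n -> A) -> Prop :=
  match phi in formula n return ('I_n -> A) -> Prop with
  | Fbot _ => fun _ => False
  | Feq _ i j => fun v => v i = v j
  | Frel _ s i j => fun v => interp s (v i) (v j)
  | Fimp _ phi1 phi2 => fun v => sat phi1 v -> sat phi2 v
  | Fall _ phi1 => fun v => forall x : A, sat phi1 (extend x v)
  end.

Fixpoint quantifier_free (n : nat) (phi : formula n) : Prop :=
  match phi with
  | Fimp _ phi1 phi2 => quantifier_free phi1 /\ quantifier_free phi2
  | Fall _ _ => False
  | _ => True
  end.

Definition no_var (A : Type) (i : 'I_0) : A :=
  match i with Ordinal _ lt_m0 => False_rect A (notF lt_m0) end.

Definition holds (A : structure) (phi : sentence) : Prop := sat phi (@no_var A).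

Definition theory := set sentence.

Definition model (T : theory) (A : structure) : Prop :=
  forall phi : sentence, T phi -> holds A phi.

Definition Th (A : structure) : theory := [set phi | holds A phi].

Definition quantifier_elimination (T : theory) : Prop :=
  forall (n : nat) (phi : formula n),
  exists psi : formula n, quantifier_free psi /\
    forall A : structure, model T A ->
    forall v : 'I_n -> A, sat phi v <-> sat psi v.

(* Exactly one countable model up to isomorphism, where "countable" includes
   "finite": when the only model of the theory is the empty structure, there
   is no infinite one. *)
Definition omega_categorical (T : theory) : Prop :=
  exists A : structure, [/\ model T A, countable_structure A &
    forall B : structure, model T B -> countable_structure B -> isomorphic A B].

(* The third clause is the completeness of T' together with the diagram of A,
   for every model A of T: models of the diagram of A are structures B with
   an embedding of A into B, and sentences with constants from A are formulas
   evaluated at tuples from A. *)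
Definition model_completion (T T' : theory) : Prop :=
  [/\ forall A : structure, model T' A -> model T A,
      forall A : structure, model T A ->
        exists B : structure, model T' B /\ exists f : A -> B, embedding f
    & forall A B1 B2 : structure, model T A -> model T' B1 -> model T' B2 ->
      forall (f1 : A -> B1) (f2 : A -> B2), embedding f1 -> embedding f2 ->
      forall (n : nat) (phi : formula n) (v : 'I_n -> A),
        sat phi (f1 \o v) <-> sat phi (f2 \o v)].

Definition age (M : structure) : set structure :=
  [set A | finite_structure A /\ exists f : A -> M, embedding f].

Definition ultrahomogeneous (M : structure) : Prop :=
  forall (S S' : set M) (f : substructure S -> substructure S'),
    finite_set S -> finite_set S' -> isomorphism f ->
    exists g : M -> M, isomorphism g /\
      forall x : substructure S, g (sval x) = sval (f x).

Definition fraisse_limit (K : set structure) (M : structure) : Prop :=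
  [/\ countable_structure M, age M = K & ultrahomogeneous M].

Definition finite_models (T : theory) : set structure :=
  [set A | finite_structure A /\ model T A].

Definition superamalgamation (T : theory) : Prop :=
  forall (A B C : structure) (iota1 : C -> A) (kappa1 : C -> B),
    model T A -> model T B -> model T C ->
    embedding iota1 -> embedding kappa1 ->
    exists (D : structure) (iota : A -> D) (kappa : B -> D),
      [/\ model T D, embedding iota, embedding kappa,
          iota \o iota1 = kappa \o kappa1
        & range iota `&` range kappa = iota @` range iota1] /\
      forall (a : A) (b : B), ~ range iota1 a -> ~ range kappa1 b ->
        (sle (iota a) (kappa b) ->
           exists c : C, sle a (iota1 c) /\ sle (kappa1 c) b) /\
        (sle (kappa b) (iota a) ->
           exists c : C, sle b (kappa1 c) /\ sle (iota1 c) a).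

Inductive rel_property := Refl | Antirefl | Antisym.

Inductive condition := CondF | CondC | CondA1 | CondA2.

(* The outermost quantifier binds the highest de Bruijn index. *)
Definition forall1 (phi : 'I_1 -> formula 1) : sentence :=
  Fall (phi (@Ordinal 1 0 isT)).

Definition forall2 (phi : 'I_2 -> 'I_2 -> formula 2) : sentence :=
  Fall (Fall (phi (@Ordinal 2 1 isT) (@Ordinal 2 0 isT))).

Definition forall3 (phi : 'I_3 -> 'I_3 -> 'I_3 -> formula 3) : sentence :=
  Fall (Fall (Fall
    (phi (@Ordinal 3 2 isT) (@Ordinal 3 1 isT) (@Ordinal 3 0 isT)))).

Definition transitivity_axiom (s : symbol) : sentence :=
  forall3 (fun x y z => Fimp (Frel s x y) (Fimp (Frel s y z) (Frel s x z))).

Definition property_axiom (s : symbol) (p : rel_property) : sentence :=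
  match p with
  | Refl => forall1 (fun x => Frel s x x)
  | Antirefl => forall1 (fun x => Fimp (Frel s x x) Fbot)
  | Antisym => forall2 (fun x y => Fimp (Frel s x y) (Fimp (Frel s y x) (Feq x y)))
  end.

Definition condition_axiom (c : condition) : sentence :=
  match c with
  | CondF => forall2 (fun x y => Fimp (Frel Ll x y) (Frel Leq x y))
  | CondC => forall2 (fun x y => Fimp (Frel Leq x y) (Frel Ll x y))
  | CondA1 =>
      forall3 (fun w x y => Fimp (Frel Leq w x) (Fimp (Frel Ll x y) (Frel Ll w y)))
  | CondA2 =>
      forall3 (fun x y z => Fimp (Frel Ll x y) (Fimp (Frel Leq y z) (Frel Ll x z)))
  end.

Definition T_ (P Q : set rel_property) (N : set condition) : theory :=
  range transitivity_axiom `|` property_axiom Leq @` P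
    `|` property_axiom Ll @` Q `|` condition_axiom @` N.

Definition rel_property_holds (X : Type) (R : X -> X -> Prop) (p : rel_property) :=
  match p with
  | Refl => forall x, R x x
  | Antirefl => forall x, ~ R x x
  | Antisym => forall x y, R x y -> R y x -> x = y
  end.

Definition condition_holds (A : structure) (c : condition) : Prop :=
  match c with
  | CondF => forall x y : A, sll x y -> sle x y
  | CondC => forall x y : A, sle x y -> sll x y
  | CondA1 => forall w x y : A, sle w x -> sll x y -> sll w y
  | CondA2 => forall x y z : A, sll x y -> sle y z -> sll x z
  end.

Lemma model_T_E (P Q : set rel_property) (N : set condition) (A : structure) :
  model (T_ P Q N) A <->
  [/\ (forall x y z : A, sle x y -> sle y z -> sle x z),
      (forall x y z : A, sll x y -> sll y z -> sll x z),
      (forall p, P p -> rel_property_holds (@sle A) p),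
      (forall q, Q q -> rel_property_holds (@sll A) q)
    & (forall c, N c -> condition_holds A c)].
Proof.
split=> [mA|[tle tll hP hQ hN] phi].
  split.
  - by apply: (mA (transitivity_axiom Leq)); do 3 left; exists Leq.
  - by apply: (mA (transitivity_axiom Ll)); do 3 left; exists Ll.
  - move=> p Pp.
    have: holds A (property_axiom Leq p) by apply: mA; left; left; right; exists p.
    by case: p {Pp}.
  - move=> q Qq.
    have: holds A (property_axiom Ll q) by apply: mA; left; right; exists q.
    by case: q {Qq}.
  - move=> c Nc.
    have: holds A (condition_axiom c) by apply: mA; right; exists c.
    by case: c {Nc}.
by case=> [[[[[|] _ <-]|[p /hP h <-]]|[q /hQ h <-]]|[c /hN h <-]] //;
   [case: p h | case: q h | case: c h].
Qed.

(* Main.v *)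
(** The superamalgam of [A] and [B] over [C] lives on the disjoint union of [A]
and [B] modulo [C].  Two points on different sides are related by [s] when they
are joined through a point of [C] by two steps whose composite the axioms force
to be an [s]-step: [<= <=] for [<=], and for [<<] the pair [<< <<] together with
[<= <<] under A1 and [<< <=] under A2.  The hypothesis on [P], [Q], [N] is what
makes [<<] transitive and antisymmetric there.

Since the amalgam identifies nothing outside [C], a generic model [M] can be
built on an initial segment of [nat], adding one point at a time.  It satisfies
the one-point extension property over every model of the theory; back-and-forth
then gives ultrahomogeneity.  As there are finitely many atomic types of
[n]-tuples, and automorphisms act transitively on the tuples of each, every
formula is equivalent in [M] to a disjunction of type descriptions; this is
quantifier elimination, and it turns the extension property into a consequence
of [Th M], whence omega-categoricity.  Every model embeds into an ultrapower of
[M], because its finite parts embed into [M]. *)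

Require Import Defs.
From mathcomp Require Import all_boot.
From mathcomp Require Import boolp classical_sets functions cardinality filter.

Set Implicit Arguments.
Unset Strict Implicit.
Unset Printing Implicit Defensive.

Local Open Scope classical_set_scope.

(** * Tuples, atomic types and formulas *)

Lemma extend0 (A : Type) n (x : A) (v : 'I_n -> A) : extend x v ord0 = x.
Proof. by []. Qed.

Lemma extend_lift (A : Type) n (x : A) (v : 'I_n -> A) i :
  extend x v (lift ord0 i) = v i.
Proof. by rewrite /=; congr v; apply: val_inj. Qed.

Variant ord_succ_spec n : 'I_n.+1 -> Type :=
| OrdZero : ord_succ_spec ord0
| OrdSucc (i : 'I_n) : ord_succ_spec (lift ord0 i).

Lemma ord_succP n (i : 'I_n.+1) : ord_succ_spec i.
Proof. by case: (unliftP ord0 i) => [j|] ->; constructor. Qed.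

Lemma extend_eta (A : Type) n (v : 'I_n.+1 -> A) :
  extend (v ord0) (v \o lift ord0) = v.
Proof. by apply/funext => i; case: (ord_succP i) => [|j] //; rewrite extend_lift. Qed.

Lemma comp_extend (A B : Type) (f : A -> B) n (x : A) (v : 'I_n -> A) :
  f \o extend x v = extend (f x) (f \o v).
Proof.
by apply/funext => i /=; case: (ord_succP i) => [|j] //; rewrite !extend_lift.
Qed.

Lemma ord0_fun (A : Type) (u v : 'I_0 -> A) : u = v.
Proof. by apply/funext => -[]. Qed.

Definition same_type (A B : structure) n (u : 'I_n -> A) (v : 'I_n -> B) : Prop :=
  (forall i j, u i = u j <-> v i = v j) /\
  (forall s i j, interp s (u i) (u j) <-> interp s (v i) (v j)).

Lemma same_type_sym (A B : structure) n (u : 'I_n -> A) (v : 'I_n -> B) :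
  same_type u v -> same_type v u.
Proof. by case=> e r; split=> [i j|s i j]; [rewrite e | rewrite r]. Qed.

Lemma same_type_embedding (A B : structure) (f : A -> B) n (v : 'I_n -> A) :
  embedding f -> same_type v (f \o v).
Proof. by case=> fi fr; split=> [i j|s i j] //=; split=> [->//|/fi]. Qed.

Lemma same_type_extend_old (A B : structure) n (u : 'I_n -> A) (v : 'I_n -> B) i :
  same_type u v -> same_type (extend (u i) u) (extend (v i) v).
Proof.
move=> [e r]; split=> [j k|s j k]; case: (ord_succP j) => [|j'];
  by case: (ord_succP k) => [|k']; rewrite ?extend_lift ?extend0.
Qed.

Lemma sat_qf (A B : structure) n (phi : formula n) (u : 'I_n -> A) (v : 'I_n -> B) :
  same_type u v -> quantifier_free phi -> sat phi u <-> sat phi v.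
Proof.
move=> uv; elim: phi u v uv => [{}n|{}n i j|{}n s i j|{}n p IHp q IHq|{}n p IHp] //=
  u v uv.
- by move=> _; apply: uv.1.
- by move=> _; apply: uv.2.
- by move=> [/(IHp _ _ uv) hp /(IHq _ _ uv) hq]; rewrite hp hq.
Qed.

Lemma sat_isomorphism (A B : structure) (g : A -> B) n (phi : formula n)
  (v : 'I_n -> A) : isomorphism g -> sat phi v <-> sat phi (g \o v).
Proof.
move=> [[gi gr] [g' gK g'K]].
elim: phi v => [{}n|{}n i j|{}n s i j|{}n p IHp q IHq|{}n p IHp] //= v.
- by split=> [->//|/gi].
- by rewrite IHp IHq.
- split=> h x; last by rewrite IHp comp_extend.
  by rewrite -[x]g'K -comp_extend -IHp.
Qed.

(** * Derived connectives, finite conjunctions and disjunctions *)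

Definition Fnot n (p : formula n) := Fimp p Fbot.
Definition For n (p q : formula n) := Fimp (Fnot p) q.
Definition Fand n (p q : formula n) := Fnot (Fimp p (Fnot q)).
Definition Fex n (p : formula n.+1) := Fnot (Fall (Fnot p)).
Definition Flit n (b : bool) (p : formula n) := if b then p else Fnot p.
Definition Fall_in n (I : Type) (r : seq I) (F : I -> formula n) :=
  foldr (fun i p => Fand (F i) p) (Fnot Fbot) r.
Definition Fex_in n (I : Type) (r : seq I) (F : I -> formula n) :=
  foldr (fun i p => For (F i) p) Fbot r.

Section Connectives.
Variables (A : structure) (n : nat) (v : 'I_n -> A).

Lemma sat_or (p q : formula n) : sat (For p q) v <-> sat p v \/ sat q v.
Proof.
split=> /= [h|[hp|hq]] //; case: (pselect (sat p v)) => hp; first by left.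
by right; apply: h.
Qed.

Lemma sat_and (p q : formula n) : sat (Fand p q) v <-> sat p v /\ sat q v.
Proof.
split=> [|[p1 p2]] /= h; last exact: h.
by split; apply: contrapT => hn; apply: h.
Qed.

Lemma sat_ex (p : formula n.+1) : sat (Fex p) v <-> exists x, sat p (extend x v).
Proof.
split=> [h|[x hx] /= h]; last exact: (h x).
by apply: contrapT => hn; apply: h => x hx; apply: hn; exists x.
Qed.

Lemma sat_lit b (p : formula n) : sat (Flit b p) v <-> (sat p v <-> b).
Proof.
case: b => /=.
  by split=> [hp|[_ h]]; [split | apply: h].
by split=> [hp|[h _] /h]; [split | ].
Qed.

Lemma sat_all_in (I : eqType) (r : seq I) (F : I -> formula n) :
  sat (Fall_in r F) v <-> forall i, i \in r -> sat (F i) v.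
Proof.
elim: r => [|i r IH]; first by split=> _ /=.
rewrite sat_and IH; split=> [[hi hr] j|h].
  by rewrite inE => /predU1P[->|/hr].
by split=> [|j jr]; apply: h; rewrite inE ?eqxx ?jr ?orbT.
Qed.

Lemma sat_ex_in (I : eqType) (r : seq I) (F : I -> formula n) :
  sat (Fex_in r F) v <-> exists2 i, i \in r & sat (F i) v.
Proof.
elim: r => [|i r IH]; first by split=> // -[].
rewrite sat_or IH; split=> [[hi|[j jr hj]]|[j]].
- by exists i => //; rewrite inE eqxx.
- by exists j => //; rewrite inE jr orbT.
- by rewrite inE => /predU1P[->|jr hj]; [left | right; exists j].
Qed.

End Connectives.

(** A finite type, so that a disjunction over atomic types of [n]-tuples is a formula. *)
Definition type_code n := {ffun 'I_n * 'I_n -> bool * bool * bool}.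

Definition code (A : structure) n (u : 'I_n -> A) : type_code n :=
  [ffun p => (`[<u p.1 = u p.2>], `[<sle (u p.1) (u p.2)>],
              `[<sll (u p.1) (u p.2)>])].

Lemma codeP (A B : structure) n (u : 'I_n -> A) (v : 'I_n -> B) :
  code u = code v <-> same_type u v.
Proof.
split=> [/ffunP h|[e r]].
  by split=> [i j|[] i j]; have := h (i, j); rewrite !ffunE =>
    -[h1 h2 h3];
    [exact: (asbool_eq_equiv h1) | exact: (asbool_eq_equiv h2)
    | exact: (asbool_eq_equiv h3)].
by apply/ffunP => -[i j]; rewrite !ffunE /=; congr (_, _, _);
  apply: asbool_equiv_eq; rewrite ?e // /sle /sll ?r.
Qed.

Definition code_formula n (t : type_code n) : formula n :=
  Fall_in (enum {: 'I_n * 'I_n}) (fun p =>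
    Fand (Flit (t p).1.1 (Feq p.1 p.2))
   (Fand (Flit (t p).1.2 (Frel Leq p.1 p.2)) (Flit (t p).2 (Frel Ll p.1 p.2)))).

Lemma code_formula_qf n (t : type_code n) : quantifier_free (code_formula t).
Proof.
rewrite /code_formula; elim: (enum _) => [|p r IH] //=.
by case: (t p) => -[[] []] [].
Qed.

Lemma sat_code_formula (A : structure) n (t : type_code n) (v : 'I_n -> A) :
  sat (code_formula t) v <-> code v = t.
Proof.
rewrite sat_all_in; split=> [h|<- p _].
  apply/ffunP => p; have := h p (mem_enum _ p).
  rewrite !sat_and !sat_lit ffunE.
  case: (t p) => -[b1 b2] b3 /= [h1 [h2 h3]].
  by congr (_, _, _); apply: (asbool_equiv_eqP idP).
by rewrite !sat_and !sat_lit ffunE /=; split; [|split]; split=> /asboolP.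
Qed.

(** Turns an equivalence valid at all tuples of [M] into a sentence of [Th M], which then holds in
    every model of [Th M]. *)
Fixpoint universal_closure n : formula n -> sentence :=
  match n return formula n -> sentence with
  | 0 => id
  | _.+1 => fun p => universal_closure (Fall p)
  end.

Lemma holds_universal_closure (A : structure) n (p : formula n) :
  holds A (universal_closure p) <-> forall v : 'I_n -> A, sat p v.
Proof.
elim: n p => [|n IH] p /=.
  by split=> [h v|]; [rewrite (ord0_fun v (@no_var A)) | apply].
rewrite IH; split=> /= h v; last by move=> x; apply: h.
by rewrite -(extend_eta v); apply: h.
Qed.

Lemma finite_enum (T : Type) (S : set T) : finite_set S ->
  exists n (u : 'I_n -> T), range u = S.
Proof.
move=> [n /card_esym/card_eqP[f]]; exists n.
have mI (i : 'I_n) : (i : nat) \in `I_n by rewrite inE /= ltn_ord.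
exists (fun i : 'I_n => val (f (exist _ (i : nat) (mI i)))).
apply/seteqP; split=> [_ [i _ <-]|x Sx].
  exact: set_valP.
have /= [[m mn] _ fm] := 'surj_f (I : [set: S] (SigSub (mem_set Sx))).
have ltm : m < n by have := mn; rewrite inE.
exists (Ordinal ltm) => //.
by rewrite (_ : exist _ _ _ = exist _ m mn) ?fm //; apply: val_inj.
Qed.

(** * Back-and-forth and quantifier elimination *)

(** Finite partial isomorphisms are presented by two listings of the same atomic type, with
    repetitions allowed. *)
Definition extension_property (A B : structure) : Prop :=
  forall n (u : 'I_n -> A) (v : 'I_n -> B), same_type u v ->
  forall a, exists b, same_type (extend a u) (extend b v).

Section BackAndForth.
Variables A B : structure.
Hypotheses (cA : countable_structure A) (cB : countable_structure B).
Hypotheses (AB : extension_property A B) (BA : extension_property B A).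

(** Graphs forget the length of the tuples, so a growing chain is ordered by inclusion and has a
    union. *)
Let graph n (u : 'I_n -> A) (v : 'I_n -> B) : set (A * B) :=
  range (fun i => (u i, v i)).

Let finite_partial_iso (R : set (A * B)) : Prop :=
  exists n (u : 'I_n -> A) (v : 'I_n -> B), same_type u v /\ R = graph u v.

Let graph_extend n (u : 'I_n -> A) (v : 'I_n -> B) a b :
  graph u v `<=` graph (extend a u) (extend b v) /\
  graph (extend a u) (extend b v) (a, b).
Proof.
split; last by exists ord0.
by move=> _ [i _ <-]; exists (lift ord0 i) => //; rewrite !extend_lift.
Qed.

Let forth R a : finite_partial_iso R ->
  exists R', [/\ finite_partial_iso R', R `<=` R' & exists b, R' (a, b)].
Proof.
move=> [n [u [v [uv ->]]]]; have [b abuv] := AB uv a.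
have [sub hab] := graph_extend u v a b.
exists (graph (extend a u) (extend b v)); split=> //; last by exists b.
by exists n.+1, (extend a u), (extend b v).
Qed.

Let back R b : finite_partial_iso R ->
  exists R', [/\ finite_partial_iso R', R `<=` R' & exists a, R' (a, b)].
Proof.
move=> [n [u [v [uv ->]]]]; have [a abuv] := BA (same_type_sym uv) b.
have [sub hab] := graph_extend u v a b.
exists (graph (extend a u) (extend b v)); split=> //; last by exists a.
exists n.+1, (extend a u), (extend b v); split=> //.
exact: same_type_sym abuv.
Qed.

(** The chain starts from the graph of [u] and [v]. Step [k] takes in the point of [A] and the point
    of [B] that the injections [eA] and [eB] number [k], if they exist; the union of the chain is
    the graph of [g]. *)
Lemma back_and_forth n (u : 'I_n -> A) (v : 'I_n -> B) : same_type u v ->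
  exists g : A -> B, isomorphism g /\ forall i, g (u i) = v i.
Proof.
move=> uv.
have /countable_injP[eA eAi] := cA; have /countable_injP[eB eBi] := cB.
pose state := {R | finite_partial_iso R}.
have step (kR : nat * state) : exists R' : state, [/\ sval kR.2 `<=` sval R',
    forall a, eA a = kR.1 -> exists b, sval R' (a, b)
  & forall b, eB b = kR.1 -> exists a, sval R' (a, b)].
  case: kR => k [R pR] /=.
  have [R1 [pR1 RR1 R1a]] : exists R1, [/\ finite_partial_iso R1, R `<=` R1
      & forall a, eA a = k -> exists b, R1 (a, b)].
    have [[a <-]|nA] := pselect (exists a, eA a = k).
      have [R1 [pR1 RR1 [b hb]]] := forth a pR; exists R1; split=> // a'.
      by move=> /eAi -> //; [exists b | rewrite inE | rewrite inE].
    by exists R; split=> // a ea; case: nA; exists a.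
  have [R2 [pR2 RR2 R2b]] : exists R2, [/\ finite_partial_iso R2, R1 `<=` R2
      & forall b, eB b = k -> exists a, R2 (a, b)].
    have [[b <-]|nB] := pselect (exists b, eB b = k).
      have [R2 [pR2 RR2 [a ha]]] := back b pR1; exists R2; split=> // b'.
      by move=> /eBi -> //; [exists a | rewrite inE | rewrite inE].
    by exists R1; split=> // b eb; case: nB; exists b.
  exists (exist _ R2 pR2); split=> //= [x /RR1/RR2 //|a /R1a[b /RR2 hb]].
  by exists b.
have [next nextP] := choice step.
have p0 : finite_partial_iso (graph u v) by exists n, u, v.
pose fix stage k : state :=
  if k is k'.+1 then next (k', stage k') else exist _ (graph u v) p0.
pose R k := sval (stage k).
have Rmono k l : k <= l -> R k `<=` R l.
  elim: l => [|l IH]; first by rewrite leqn0 => /eqP->.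
  rewrite leq_eqVlt => /predU1P[->//|/IH h] x /h.
  by case: (nextP (l, stage l)) => h1 _ _ /h1.
(* Two pairs of the union lie in a common stage, so the union is functional, injective and respects
   both symbols. *)
have Rpair p q : (exists k, R k p) -> (exists k, R k q) ->
    (p.1 = q.1 <-> p.2 = q.2) /\
    forall s, interp s p.1 q.1 <-> interp s p.2 q.2.
  move=> [k kp] [l lq].
  have {kp}kp := Rmono _ _ (leq_maxl k l) _ kp.
  have {lq}lq := Rmono _ _ (leq_maxr k l) _ lq.
  have [m [u' [v' [[e r]]]]] := svalP (stage (maxn k l)).
  move: kp lq; rewrite /R => + + RE; rewrite RE.
  by move=> [i _ <-] [j _ <-] /=; split=> [|s]; [exact: e | exact: r].
have tot a : exists b, exists k, R k (a, b).
  have [_ h _] := nextP (eA a, stage (eA a)).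
  by have [b hb] := h a erefl; exists b, (eA a).+1.
have sur b : exists a, exists k, R k (a, b).
  have [_ _ h] := nextP (eB b, stage (eB b)).
  by have [a ha] := h b erefl; exists a, (eB b).+1.
have [g gP] := choice tot; have [g' g'P] := choice sur.
exists g; split; last first.
  move=> i; apply: (Rpair (u i, g (u i)) (u i, v i) _ _).1.1 => //.
  by exists 0; exists i.
split.
  split=> [x y gxy|s x y]; first exact: (Rpair _ _ (gP x) (gP y)).1.2.
  exact: (Rpair _ _ (gP x) (gP y)).2.
exists g' => [a|b].
  exact: (Rpair _ _ (g'P (g a)) (gP a)).1.2.
exact: (Rpair _ _ (gP (g' b)) (g'P b)).1.1.
Qed.

End BackAndForth.

Lemma sval_inj (T : Type) (S : set T) : injective (@sval T S).
Proof. by move=> [x p] [y q] /= xy; exact: eq_exist. Qed.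

(** [psi] is the disjunction of the atomic types realised in [M] by a tuple satisfying [phi]. Any
    tuple of [M] of such a type is the image of a satisfying one under an automorphism. *)
Lemma extension_qe (M : structure) : countable_structure M ->
  extension_property M M -> quantifier_elimination (Th M).
Proof.
move=> cM MM n phi.
pose good (t : type_code n) := `[<exists u : 'I_n -> M, code u = t /\ sat phi u>].
pose psi := Fex_in [seq t <- enum {: type_code n} | good t] (@code_formula n).
have psiE (A : structure) (v : 'I_n -> A) :
    sat psi v <-> exists u : 'I_n -> M, same_type u v /\ sat phi u.
  rewrite sat_ex_in; split=> [[t]|[u [uv pu]]].
    rewrite mem_filter => /andP[/asboolP[u [ut pu]] _] /sat_code_formula vt.
    by exists u; split=> //; apply/codeP; rewrite ut vt.
  exists (code v); last exact/sat_code_formula.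
  rewrite mem_filter mem_enum andbT; apply/asboolP; exists u; split=> //.
  exact/codeP.
exists psi; split.
  rewrite /psi; elim: [seq t <- _ | _] => //= t r IH.
  by split=> //; split=> //; exact: code_formula_qf.
pose iff_formula := Fand (Fimp phi psi) (Fimp psi phi).
suff iffM : holds M (universal_closure iff_formula).
  move=> A mA v; have /holds_universal_closure/(_ v) := mA _ iffM.
  by move=> /sat_and[].
apply/holds_universal_closure => v; apply/sat_and; split=> /=.
  by move=> h; apply/psiE; exists v; split=> //; split.
move=> /psiE[u [uv pu]]; have [g [gi guv]] := back_and_forth cM cM MM MM uv.
have -> : v = g \o u by apply/funext => i /=; rewrite guv.
exact: ((sat_isomorphism phi u gi).1 pu).
Qed.

(** That some point has a prescribed type over a tuple is a first-order property of the tuple. Its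
    quantifier-free equivalent depends only on the atomic type, so it passes from [u] to [v]. *)
Lemma qe_extension_property (T : theory) (A B : structure) :
  quantifier_elimination T -> model T A -> model T B -> extension_property A B.
Proof.
move=> qe mA mB n u v uv a.
have [psi [qf psiE]] := qe n (Fex (code_formula (code (extend a u)))).
have /psiE : sat (Fex (code_formula (code (extend a u)))) u.
  by apply/sat_ex; exists a; apply/sat_code_formula.
move=> /(_ mA)/(sat_qf uv qf)/psiE -/(_ mB)/sat_ex[b /sat_code_formula ab].
by exists b; apply/codeP.
Qed.

Lemma qe_omega_categorical (M : structure) : countable_structure M ->
  quantifier_elimination (Th M) -> omega_categorical (Th M).
Proof.
move=> cM qe; exists M; split=> // B mB cB.
have mM : model (Th M) M by [].
have [g [gi _]] := back_and_forth cM cB (qe_extension_property qe mM mB)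
  (qe_extension_property qe mB mM) (n := 0) (u := @no_var M) (v := @no_var B)
  ltac:(by split=> [[]|s []]).
by exists g.
Qed.

(** Embeddings preserve and reflect quantifier-free formulas, so both sides amount to the truth of
    [psi] in [A] at [v]. *)
Lemma qe_diagram_complete (T : theory) (A B1 B2 : structure) (f1 : A -> B1)
    (f2 : A -> B2) n (phi : formula n) (v : 'I_n -> A) :
  quantifier_elimination T -> model T B1 -> model T B2 ->
  embedding f1 -> embedding f2 -> sat phi (f1 \o v) <-> sat phi (f2 \o v).
Proof.
move=> qe m1 m2 e1 e2; have [psi [qf psiE]] := qe n phi.
rewrite psiE // psiE // -(sat_qf (same_type_embedding v e1) qf).
by rewrite -(sat_qf (same_type_embedding v e2) qf).
Qed.

Lemma extension_ultrahomogeneous (M : structure) :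
  countable_structure M -> extension_property M M -> ultrahomogeneous M.
Proof.
move=> cM MM S S' f fS fS' [[fi fr] _].
have [n [u uS]] := finite_enum fS.
have Su i : S (u i) by rewrite -uS; exists i.
pose v i := sval (f (exist _ (u i) (Su i))).
have [|g [gi guv]] := back_and_forth cM cM MM MM (u := u) (v := v).
  split=> [i j|s i j]; last first.
    exact: (fr s (exist _ (u i) (Su i)) (exist _ (u j) (Su j))).
  split=> [uij|/sval_inj/fi[] //].
  by rewrite /v; congr (sval (f _)); exact: sval_inj.
exists g; split=> // -[x Sx] /=; have [i _ ux] : range u x by rewrite uS.
by rewrite -[in LHS]ux guv /v; congr (sval (f _)); exact: sval_inj.
Qed.

(** * Ultrapowers *)

Section Ultrapower.
Variables (M : structure) (I : Type) (U : set_system I).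
Hypothesis UF : UltraFilter U.

Let PU : ProperFilter U := @ultra_proper _ _ UF.
Let FU : Filter U := @filter_filter _ _ PU.

(* Not typed as a [set], whose universe is above that of carriers. *)
Definition ultra_class (f g : I -> M) : Prop := U [set i | f i = g i].

(** Elements are classes rather than representatives, because [Feq] is interpreted by equality. *)
Definition ultrapower : structure :=
  @Structure {c : (I -> M) -> Prop | exists f, c = ultra_class f}
    (fun s x y => exists f g, [/\ sval x = ultra_class f, sval y = ultra_class g
       & U [set i | interp s (f i) (g i)]]).

Definition ultra_inj (f : I -> M) : ultrapower :=
  exist _ (ultra_class f) (ex_intro _ f erefl).

Lemma ultra_inj_surj (x : ultrapower) : exists f, x = ultra_inj f.
Proof. by case: x => c [f fc]; exists f; exact: sval_inj. Qed.

Lemma ultra_classP f g : ultra_class f = ultra_class g <-> U [set i | f i = g i].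
Proof.
split=> [fg|fg].
  suff : ultra_class f g by [].
  by rewrite fg /ultra_class /=; apply: filterS filterT.
apply/funext => h; apply/propext.
by split=> fh; apply: filterS (filterI fg fh) => i /= [->].
Qed.

Lemma ultra_injP f g : ultra_inj f = ultra_inj g <-> U [set i | f i = g i].
Proof.
rewrite -ultra_classP; split=> [[]//|h]; exact: sval_inj.
Qed.

Lemma interp_ultrapower s f g :
  interp s (ultra_inj f) (ultra_inj g) <-> U [set i | interp s (f i) (g i)].
Proof.
split=> [[f' [g' [/= /ultra_classP ff' /ultra_classP gg']]]|]; last by exists f, g.
by move=> h; apply: filterS (filterI (filterI ff' gg') h) => i /= [[-> ->]].
Qed.

Lemma los n (phi : formula n) (w : 'I_n -> I -> M) :
  sat phi (ultra_inj \o w) <-> U [set i | sat phi (w ^~ i)].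
Proof.
elim: phi w => [{}n|{}n j k|{}n s j k|{}n p IHp q IHq|{}n p IHp] w /=.
- split=> // h; exact: (filter_not_empty U).
- exact: ultra_injP.
- exact: interp_ultrapower.
- rewrite IHp IHq; split=> [h|h hp].
    have [hp|hp] := in_ultra_setVsetC [set i | sat p (w^~ i)] UF.
      by apply: filterS (h hp) => i /=.
    by move: hp; apply: filterS => i /= np /np.
  by apply: filterS (filterI h hp) => i /= [].
- have ext (f : I -> M) i : (extend f w)^~ i = extend (f i) (w^~ i).
    by apply/funext => j; case: (ord_succP j) => [|j'] //; rewrite !extend_lift.
  split=> [h|h x]; last first.
    have [f ->] := ultra_inj_surj x.
    rewrite -comp_extend; apply/IHp; move: h; apply: filterS => i /= h.
    by rewrite ext.
  (* If the universal formula fails at almost all coordinates, a choice of counterexamples gives an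
     [f] that contradicts [h]. The point [x0] serves as a value where there is no counterexample. *)
  have [//|hN] := in_ultra_setVsetC [set i | forall x, sat p (extend x (w^~ i))] UF.
  have [i0 /= /existsNP[x0 _]] := filter_ex hN.
  have /choice[f fP] i : exists y : M,
      ~ (forall x, sat p (extend x (w^~ i))) -> ~ sat p (extend y (w^~ i)).
    have [hi|/existsNP[x hx]] := pselect (forall x, sat p (extend x (w^~ i))).
      by exists x0.
    by exists x.
  have := h (ultra_inj f); rewrite -comp_extend => /IHp hf.
  have [i [/= hi1 /fP]] := filter_ex (filterI hf hN).
  by rewrite -ext.
Qed.

Lemma ultrapower_Th : model (Th M) ultrapower.
Proof.
move=> phi Mphi; rewrite /holds (ord0_fun (@no_var _) (ultra_inj \o (@no_var _))).
apply/los; apply: filterS filterT => i _ /=.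
by rewrite (ord0_fun (_^~ i) (@no_var M)).
Qed.

End Ultrapower.

(** The ultrapower is indexed by the finite lists of points of [A]. At the list [l], the map [f l]
    preserves and reflects equality and both symbols on the entries of [l]; a point [a] goes to the
    class of the family of all [f l a]. *)
Lemma embed_in_Th_model (A M : structure) :
  (forall n (u : 'I_n -> A), exists v : 'I_n -> M, same_type u v) ->
  exists B, model (Th M) B /\ exists f : A -> B, embedding f.
Proof.
move=> loc.
(* An empty [A] embeds in [M] itself; otherwise [a0] is the default for [nth]. *)
have [[a0]|nA] := pselect (inhabited A); last first.
  exists M; split=> //; have h (a : A) : False by apply: nA; constructor.
  by exists (fun a => False_rect _ (h a)); split=> [a|s a]; case: (h a).
have [m0 _] : exists m : M, True.
  by have [v _] := loc 1 (fun=> a0); exists (v ord0).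
(* The index type is [seq A]: families indexed by ordinals live in the universe
   of [predArgType], which is not below that of carriers. *)
pose tuple_of (l : seq A) (i : 'I_(size l)) : A := nth a0 l i.
have /choice[f fP] (l : seq A) : exists g : A -> M, forall x y,
    range (tuple_of l) x -> range (tuple_of l) y ->
    (x = y <-> g x = g y) /\
    forall s, interp s x y <-> interp s (g x) (g y).
  set u := tuple_of l; have [v [e r]] := loc _ u.
  have /choice[g gP] x : exists y : M, forall i, u i = x -> y = v i.
    have [[i <-]|nx] := pselect (exists i, u i = x).
      by exists (v i) => j /e ->.
    by exists m0 => i ui; case: nx; exists i.
  exists g => x y [i _ ix] [j _ jy].
  rewrite (gP _ _ ix) (gP _ _ jy) -ix -jy; split=> [|s]; [exact: e | exact: r].
(* The filter generated by the cones of lists that contain all entries of a given one. For an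
   ultrafilter above it, almost every list contains any two given points. *)
pose F : set_system (seq A) :=
  [set X | exists i : seq A, forall j : seq A,
    range (tuple_of i) `<=` range (tuple_of j) -> X j].
have FF : ProperFilter F.
  split; first by move=> [i /(_ i)]; apply.
  split.
  - by exists [::].
  - move=> X Y [l1 X1] [l2 Y2]; exists (l1 ++ l2) => l sub.
    split; [apply: X1 | apply: Y2] => _ [i _ <-]; apply: sub.
      have lt_i : i < size (l1 ++ l2) by rewrite size_cat ltn_addr.
      by exists (Ordinal lt_i) => //; rewrite /tuple_of /= nth_cat ltn_ord.
    have lt_i : size l1 + i < size (l1 ++ l2) by rewrite size_cat ltn_add2l.
    exists (Ordinal lt_i) => //.
    by rewrite /tuple_of /= nth_cat ltnNge leq_addr /= addKn.
  - by move=> X Y XY [i Xi]; exists i => j /Xi/XY.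
have [U [UF FU]] := ultraFilterLemma FF.
have Ufilter : Filter U := @filter_filter _ _ (@ultra_proper _ _ UF).
have covered x y : U [set i : seq A | range (tuple_of i) x /\ range (tuple_of i) y].
  apply: FU; exists [:: x; y] => j /= sub.
  by split; apply: sub; [exists ord0 | exists ord_max].
exists (ultrapower M U); split; first exact: ultrapower_Th.
exists (fun a => ultra_inj U (f^~ a)); split=> [x y /(ultra_injP UF) xy|s x y].
  have [i [/= e [ix iy]]] := filter_ex (filterI xy (covered x y)).
  exact/(fP i x y ix iy).1.
rewrite interp_ultrapower; split=> [h|h].
  by apply: filterS (covered x y) => i /= [ix iy]; apply/(fP i x y ix iy).2.
have [i [/= e [ix iy]]] := filter_ex (filterI h (covered x y)).
exact/(fP i x y ix iy).2.
Qed.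

(** * Superamalgamation *)

Section Superamalgam.
Variables (P Q : set rel_property) (N : set condition).
Hypothesis hPQN : (N CondA1 /\ N CondA2)
         \/ (~ N CondA1 /\ ~ N CondA2)
         \/ (N CondF /\ (P Antisym \/ Q Antirefl \/ ~ Q Antisym)).

Variables (A B C : structure) (D : Type) (iota1 : C -> A) (kappa1 : C -> B).
Variables (iota : A -> D) (kappa : B -> D).
Hypotheses (mA : model (T_ P Q N) A) (mB : model (T_ P Q N) B).
Hypotheses (eA : embedding iota1) (eB : embedding kappa1).
Hypotheses (iotaI : injective iota) (kappaI : injective kappa).
Hypothesis meet : forall a b, iota a = kappa b ->
  exists c, a = iota1 c /\ b = kappa1 c.
Hypothesis cover : forall d, range iota d \/ range kappa d.

(** Indexing the sides by Booleans lets one argument serve both, [~~ t] being the opposite side. *)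
Let side (t : bool) : structure := if t then A else B.
Let inc (t : bool) : side t -> D :=
  match t return side t -> D with true => iota | false => kappa end.
Let dom t : set D := range (@inc t).
Let R t s (x y : D) : Prop :=
  exists a b : side t, [/\ x = inc a, y = inc b & interp s a b].

Let incI t : injective (@inc t).
Proof. by case: t. Qed.

Let mside t : model (T_ P Q N) (side t).
Proof. by case: t. Qed.

Let dom_cover d t : ~ dom t d -> dom (~~ t) d.
Proof. by case: t; case: (cover d). Qed.

Let R_dom t s x y : R t s x y -> dom t x /\ dom t y.
Proof. by move=> [a [b [-> -> _]]]; split; [exists a | exists b]. Qed.

(** Points in both images come from [C] by [meet], and both embeddings of [C] reflect and preserve
    its relations. *)
Let R_switch t t' s x y : R t s x y -> dom t' x -> dom t' y -> R t' s x y.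
Proof.
have [<-//|tt'] := eqVneq t t'.
move=> [a [b [-> -> ab]]] [a' _ aa'] [b' _ bb'].
case: t t' tt' a b ab a' aa' b' bb' => -[] //= _ a b ab a' aa' b' bb'.
  have [c [ac ac']] := meet (esym aa'); have [d [bd bd']] := meet (esym bb').
  exists a', b'; split=> //; move: ab; rewrite ac ac' bd bd'.
  by move=> /(eA.2 _ _ _)/(eB.2 _ _ _).
have [c [ac ac']] := meet aa'; have [d [bd bd']] := meet bb'.
exists a', b'; split=> //; move: ab; rewrite ac ac' bd bd'.
by move=> /(eB.2 _ _ _)/(eA.2 _ _ _).
Qed.

Let R_comp t (s1 s2 s3 : symbol) :
  (forall x y z : side t, interp s1 x y -> interp s2 y z -> interp s3 x z) ->
  forall x y z, R t s1 x y -> R t s2 y z -> R t s3 x z.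
Proof.
move=> h x y z [a [b [-> -> ab]]] [b' [c [/incI bb' -> bc]]].
by exists a, c; split=> //; apply: h ab _; rewrite bb'.
Qed.

Let R_trans t s x y z : R t s x y -> R t s y z -> R t s x z.
Proof.
apply: R_comp; have /model_T_E[tle tll _ _ _] := mside t.
by case: s; [exact: tle | exact: tll].
Qed.

Let R_A1 t x y z : N CondA1 -> R t Leq x y -> R t Ll y z -> R t Ll x z.
Proof.
move=> a1; apply: R_comp; have /model_T_E[_ _ _ _ hN] := mside t.
exact: (hN _ a1).
Qed.

Let R_A2 t x y z : N CondA2 -> R t Ll x y -> R t Leq y z -> R t Ll x z.
Proof.
move=> a2; apply: R_comp; have /model_T_E[_ _ _ _ hN] := mside t.
exact: (hN _ a2).
Qed.

Let R_F t x y : N CondF -> R t Ll x y -> R t Leq x y.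
Proof.
move=> f [a [b [-> -> ab]]]; exists a, b; split=> //.
have /model_T_E[_ _ _ _ hN] := mside t; exact: (hN _ f).
Qed.

Let R_C t x y : N CondC -> R t Leq x y -> R t Ll x y.
Proof.
move=> f [a [b [-> -> ab]]]; exists a, b; split=> //.
have /model_T_E[_ _ _ _ hN] := mside t; exact: (hN _ f).
Qed.

Let composable (s1 s2 s : symbol) : Prop :=
  match s1, s2, s with
  | Leq, Leq, Leq | Ll, Ll, Ll => True
  | Leq, Ll, Ll => N CondA1
  | Ll, Leq, Ll => N CondA2
  | _, _, _ => False
  end.

Let R_composable t s1 s2 s x y z : composable s1 s2 s ->
  R t s1 x y -> R t s2 y z -> R t s x z.
Proof.
case: s1; case: s2; case: s => //= h; try exact: R_trans.
- exact: R_A1.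
- exact: R_A2.
Qed.

Let E s x y : Prop :=
  (exists t, R t s x y) \/
  exists t s1 s2 z, [/\ composable s1 s2 s, R t s1 x z & R (~~ t) s2 z y].

Let E_R t s x y : R t s x y -> E s x y.
Proof. by move=> h; left; exists t. Qed.

Let E_RR t t' s1 s2 s x z y :
  composable s1 s2 s -> R t s1 x z -> R t' s2 z y -> E s x y.
Proof.
have [<-|tt'] := eqVneq t t' => h xz zy; first exact: E_R (R_composable h xz zy).
right; exists t, s1, s2, z; split=> //.
by case: t t' tt' {xz} zy => -[].
Qed.

(** [E] adds nothing inside a side: if both ends of a crossing path lie in [t], so does its middle
    point, and both steps can be moved to [t] and composed there. *)
Let E_dom t s x y : dom t x -> dom t y -> E s x y -> R t s x y.
Proof.
move=> dx dy [[t' xy]|[t' [s1 [s2 [z [h xz zy]]]]]]; first exact: R_switch xy dx dy.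
have [_ dz1] := R_dom xz; have [dz2 _] := R_dom zy.
have dz : dom t z by case: t t' {dx dy xz zy} dz1 dz2 => -[].
exact: R_composable h (R_switch xz dx dz) (R_switch zy dz dy).
Qed.

(** The appended step either lies on the side of the second step of a crossing path and merges with
    it, or lies on the side of the first; then [y] is a common point and the whole path moves to
    that side. The assumption on [s1] and [s2] is the associativity needed for the merge. *)
Let E_R_right s s' s3 : composable s s' s3 ->
  (forall s1 s2, composable s1 s2 s ->
     exists s4, composable s2 s' s4 /\ composable s1 s4 s3) ->
  forall t x y z, E s x y -> R t s' y z -> E s3 x z.
Proof.
move=> ss' hs t x y z [[t' xy]|[t' [s1 [s2 [w [h xw wy]]]]]] yz.
  exact: E_RR ss' xy yz.
have [tt|tt] := eqVneq t (~~ t').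
  subst t; have [s4 [h4 h5]] := hs _ _ h.
  exact: E_RR h5 xw (R_composable h4 wy yz).
have {tt}tt : t = t' by case: t t' tt {xw wy yz} => -[].
subst t'; have [_ dw] := R_dom xw; have [dy _] := R_dom yz.
exact: E_R (R_composable ss' (R_composable h xw (R_switch wy dw dy)) yz).
Qed.

Let E_R_left s s' s3 : composable s' s s3 ->
  (forall s1 s2, composable s1 s2 s ->
     exists s4, composable s' s1 s4 /\ composable s4 s2 s3) ->
  forall t x y z, R t s' x y -> E s y z -> E s3 x z.
Proof.
move=> ss' hs t x y z xy [[t' yz]|[t' [s1 [s2 [w [h yw wz]]]]]].
  exact: E_RR ss' xy yz.
have [tt|tt] := eqVneq t t'.
  subst t; have [s4 [h4 h5]] := hs _ _ h.
  exact: E_RR h5 (R_composable h4 xy yw) wz.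
have {tt}tt : ~~ t' = t by case: t t' tt {xy yw wz} => -[].
rewrite {}tt in wz; have [_ dy] := R_dom xy; have [dw _] := R_dom wz.
exact: E_R (R_composable ss' xy (R_composable h (R_switch yw dy dw) wz)).
Qed.

Let E_le_R t x y z : E Leq x y -> R t Leq y z -> E Leq x z.
Proof. by apply: E_R_right => // -[] [] //= _; exists Leq. Qed.

Let E_ll_le t x y z : N CondA2 -> E Ll x y -> R t Leq y z -> E Ll x z.
Proof.
by move=> a2; apply: E_R_right => // -[] [] //= h; [exists Ll | exists Leq | exists Ll].
Qed.

Let E_le_ll t x y z : N CondA1 -> R t Leq x y -> E Ll y z -> E Ll x z.
Proof.
by move=> a1; apply: E_R_left => // -[] [] //= h; [exists Leq | exists Ll | exists Ll].
Qed.

Let E_ll_R t x y z : E Ll x y -> R t Ll y z -> E Ll x z.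
Proof.
(* The critical path is [x << w <= y << z] under A2, where merging the last two steps takes A1.
   Under F the last step weakens to [<=] and A2 applies; otherwise [hPQN] supplies A1. *)
have [f|nf] := pselect (N CondF /\ N CondA2).
  by move=> xy /(R_F f.1); apply: E_ll_le f.2 xy.
apply: E_R_right => // -[] [] //= h; [by exists Ll | | by exists Ll].
exists Ll; split=> //; case: hPQN => [[]//|[[_ /(_ h)]//|[f _]]].
by case: nf.
Qed.

Let E_F x y : N CondF -> E Ll x y -> E Leq x y.
Proof.
move=> f [[t /(R_F f)/E_R//]|[t [s1 [s2 [z [h xz zy]]]]]].
have le t' s u v : R t' s u v -> R t' Leq u v by case: s => // /(R_F f).
exact: (E_RR (s := Leq) _ (le _ _ _ _ xz) (le _ _ _ _ zy)).
Qed.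

Let E_C x y : N CondC -> E Leq x y -> E Ll x y.
Proof.
move=> f [[t /(R_C f)/E_R//]|[t [[] [[] [z [//= _ xz zy]]]]]].
exact: (E_RR (s := Ll) _ (R_C f xz) (R_C f zy)).
Qed.

Let E_A1 x y z : N CondA1 -> E Leq x y -> E Ll y z -> E Ll x z.
Proof.
move=> a1 [[t xy]|[t [[] [[] [w [//= _ xw wy]]]]]] yz; first exact: E_le_ll xy yz.
exact: E_le_ll a1 xw (E_le_ll a1 wy yz).
Qed.

Let E_A2 x y z : N CondA2 -> E Ll x y -> E Leq y z -> E Ll x z.
Proof.
move=> a2 xy [[t yz]|[t [[] [[] [w [//= _ yw wz]]]]]]; first exact: E_ll_le xy yz.
exact: E_ll_le a2 (E_ll_le a2 xy yw) wz.
Qed.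

Let E_trans s x y z : E s x y -> E s y z -> E s x z.
Proof.
case: s => xy [[t yz]|[t [s1 [s2 [w [h yw wz]]]]]].
- exact: E_le_R xy yz.
- case: s1 s2 h yw wz => -[] //= _ yw wz.
  exact: E_le_R (E_le_R xy yw) wz.
- exact: E_ll_R xy yz.
- case: s1 s2 h yw wz => -[] //= h yw wz.
  (* Here [y <= w << z] under A1. With A2 the middle step is absorbed into [x << y]; without it,
     [hPQN] forces F, and [x << y] weakens to [x <= y] so that A1 applies. *)
  + have [a2|na2] := pselect (N CondA2).
      exact: E_ll_R (E_ll_le a2 xy yw) wz.
    case: hPQN => [[_ /na2//]|[[/(_ h)//]|[f _]]].
    exact: E_A1 h (E_le_R (E_F f xy) yw) (E_R wz).
  + exact: E_ll_le h (E_ll_R xy yw) wz.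
  + exact: E_ll_R (E_ll_R xy yw) wz.
Qed.

Let R_prop t (s : symbol) (p : rel_property) :
  (if s is Leq then P p else Q p) -> rel_property_holds (@interp (side t) s) p.
Proof.
have /model_T_E[_ _ hP hQ _] := mside t.
by case: s => h; [exact: hP | exact: hQ].
Qed.

Let R_antisym t s x y : (if s is Leq then P Antisym else Q Antisym) ->
  R t s x y -> R t s y x -> x = y.
Proof.
move=> /(@R_prop t s Antisym) /= h [a [b [-> -> ab]]] [b' [a' [/incI bb' /incI aa' ba]]].
by subst b' a'; congr inc; exact: h.
Qed.

Let E_irrefl s x : (if s is Leq then P Antirefl else Q Antirefl) -> ~ E s x x.
Proof.
move=> /R_prop h xx; have [dx|/dom_cover dx] := pselect (dom true x).
  by have [a [b [-> /incI ab]]] := E_dom dx dx xx; subst b; exact: h.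
by have [a [b [-> /incI ab]]] := E_dom dx dx xx; subst b; exact: h.
Qed.

(* A cycle between the two sides passes through the common part, at a point
   that is then related in both directions to its neighbour. *)
Let E_antisym_via s x y : (if s is Leq then P Antisym else Q Antisym) ->
  (forall t s1 s2 z, composable s1 s2 s -> R t s1 x z -> R (~~ t) s2 z y ->
     E s x z /\ E s z x) ->
  E s x y -> E s y x -> x = y.
Proof.
move=> hs via xy yx.
have both t : dom t x -> dom t y -> x = y.
  by move=> dx dy; exact: (R_antisym hs (E_dom dx dy xy) (E_dom dy dx yx)).
case: (xy) => [[t /R_dom[]]|[t [s1 [s2 [z [h xz zy]]]]]]; first exact: both.
have [dx dz] := R_dom xz; have [dz' dy] := R_dom zy.
have [xz' zx] := via _ _ _ _ h xz zy.
have xzE : x = z := R_antisym hs (E_dom dx dz xz') (E_dom dz dx zx).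
by apply: both dy; rewrite xzE.
Qed.

Let E_antisym_le x y : P Antisym -> E Leq x y -> E Leq y x -> x = y.
Proof.
move=> hs xy yx; apply: (@E_antisym_via Leq _ _ hs _ xy yx) => t [] [] z //= _ xz zy.
by split; [exact: E_R xz | exact: E_trans (E_R zy) yx].
Qed.

(** Under F and antisymmetry of [<=], weaken to [<=]; under antireflexivity, the cycle gives the
    absurd [x << x]. In the remaining case A1 and A2 hold or fail together: if a crossing path has a
    [<=] step, both hold, so the cycle makes its middle point related to [x] by [<<] in both
    directions. *)
Let E_antisym_ll x y : Q Antisym -> E Ll x y -> E Ll y x -> x = y.
Proof.
move=> hs xy yx.
have [[f [p5|[q4|]]]|nc] := pselect (N CondF /\
    (P Antisym \/ Q Antirefl \/ ~ Q Antisym)); last first.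
- have {nc}A12 : (N CondA1 /\ N CondA2) \/ (~ N CondA1 /\ ~ N CondA2).
    by case: hPQN => [|[|/nc]]; auto.
  apply: (@E_antisym_via Ll _ _ hs _ xy yx) => t [] [] z //= h xz zy.
  + have a2 : N CondA2 by case: A12 => -[].
    split; first exact: E_A2 (E_trans xy yx) (E_R xz).
    exact: E_trans (E_R zy) yx.
  + have a1 : N CondA1 by case: A12 => -[].
    by split; [exact: E_R xz | exact: E_A1 a1 (E_R zy) yx].
  + by split; [exact: E_R xz | exact: E_trans (E_R zy) yx].
- by case.
- by case: (@E_irrefl Ll x q4); exact: E_trans xy yx.
- exact: E_antisym_le p5 (E_F f xy) (E_F f yx).
Qed.

Definition amalgam_rel (s : symbol) : D -> D -> Prop := E s.

Lemma amalgam_model : model (T_ P Q N) (Structure amalgam_rel).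
Proof.
have refl s x : (if s is Leq then P Refl else Q Refl) -> E s x x.
  move=> /R_prop h; case: (cover x) => -[a _ <-].
    by apply: (@E_R true); exists a, a; split=> //; exact: (h true).
  by apply: (@E_R false); exists a, a; split=> //; exact: (h false).
apply/model_T_E; split.
- exact: (@E_trans Leq).
- exact: (@E_trans Ll).
- move=> [] h x; [exact: (@refl Leq) | exact: (@E_irrefl Leq) | move=> y].
  exact: E_antisym_le.
- move=> [] h x; [exact: (@refl Ll) | exact: (@E_irrefl Ll) | move=> y].
  exact: E_antisym_ll.
- move=> [] h x y; [exact: E_F | exact: E_C | |] => z; [exact: E_A1 | exact: E_A2].
Qed.

Let inc_embedding t : @embedding (side t) (Structure amalgam_rel) (@inc t).
Proof.
split=> [|s x y]; first exact: incI.
split=> [xy|]; first by apply: E_R; exists x, y.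
move=> /(E_dom (ex_intro2 _ _ x I erefl) (ex_intro2 _ _ y I erefl)).
by move=> [a [b [/incI -> /incI ->]]].
Qed.

Lemma amalgam_embedding_l : embedding (iota : A -> Structure amalgam_rel).
Proof. exact: (inc_embedding true). Qed.

Lemma amalgam_embedding_r : embedding (kappa : B -> Structure amalgam_rel).
Proof. exact: (inc_embedding false). Qed.

(** Points outside the image of [C] lie on one side only, so the relation is a crossing path, and
    its middle point comes from [C]. *)
Lemma amalgam_le_lr (a : A) (b : B) : ~ range iota1 a -> ~ range kappa1 b ->
  amalgam_rel Leq (iota a) (kappa b) ->
  exists c, sle a (iota1 c) /\ sle (kappa1 c) b.
Proof.
move=> na nb.
have niota x : iota a <> kappa x.
  by move=> /meet[c [ac _]]; apply: na; exists c.
have nkappa x : iota x <> kappa b.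
  by move=> /meet[c [_ bc]]; apply: nb; exists c.
case=> [[[] [x [y [/= ax bx xy]]]]|]; [by case: (nkappa y)|by case: (niota x)|].
move=> [t [[] [[] [z [//= _ [x [y [ax zy xy]]] [y' [w [zy' bw yw]]]]]]]].
case: t x y ax zy xy y' w zy' bw yw => /= x y ax zy xy y' w zy' bw yw.
  have [c [yc y'c]] := meet (etrans (esym zy) zy').
  by exists c; rewrite -yc -y'c (iotaI ax) (kappaI bw).
by case: (niota x).
Qed.

Lemma amalgam_le_rl (a : A) (b : B) : ~ range iota1 a -> ~ range kappa1 b ->
  amalgam_rel Leq (kappa b) (iota a) ->
  exists c, sle b (kappa1 c) /\ sle (iota1 c) a.
Proof.
move=> na nb.
have niota x : iota a <> kappa x.
  by move=> /meet[c [ac _]]; apply: na; exists c.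
have nkappa x : iota x <> kappa b.
  by move=> /meet[c [_ bc]]; apply: nb; exists c.
case=> [[[] [x [y [/= bx ay xy]]]]|]; [by case: (nkappa x)|by case: (niota y)|].
move=> [t [[] [[] [z [//= _ [x [y [bx zy xy]]] [y' [w [zy' aw yw]]]]]]]].
case: t x y bx zy xy y' w zy' aw yw => /= x y bx zy xy y' w zy' aw yw.
  by case: (nkappa x).
have [c [y'c yc]] := meet (etrans (esym zy') zy).
by exists c; rewrite -yc -y'c (kappaI bx) (iotaI aw).
Qed.

End Superamalgam.

Lemma T_superamalgamation (P Q : set rel_property) (N : set condition) :
  (N CondA1 /\ N CondA2) \/ (~ N CondA1 /\ ~ N CondA2)
    \/ (N CondF /\ (P Antisym \/ Q Antirefl \/ ~ Q Antisym)) ->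
  superamalgamation (T_ P Q N).
Proof.
move=> hPQN A B C iota1 kappa1 mA mB _ eA eB.
pose D := (A + {b : B | ~ range kappa1 b})%type.
pose iota (a : A) : D := inl a.
(* Points of [B] coming from [C] go to their copies in [A], the others to the second summand. *)
have /choice[kappa kappaP] (b : B) : exists d : D,
    (exists c, b = kappa1 c /\ d = iota (iota1 c)) \/
    (exists nb : ~ range kappa1 b, d = inr (exist _ b nb)).
  have [[c _ cb]|nb] := pselect (range kappa1 b).
    by exists (iota (iota1 c)); left; exists c.
  by exists (inr (exist _ b nb)); right; exists nb.
have iotaI : injective iota by move=> x y [].
have kappaI : injective kappa.
  move=> x y; case: (kappaP x) => [[c [-> ->]]|[nx ->]];
    case: (kappaP y) => [[d [-> ->]]|[ny ->]] //.
    by move=> [/eA.1 ->].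
  by move=> [].
have square c : iota (iota1 c) = kappa (kappa1 c).
  case: (kappaP (kappa1 c)) => [[d [/eB.1 -> ->]]//|[nc _]].
  by case: nc; exists c.
have meet a b : iota a = kappa b -> exists c, a = iota1 c /\ b = kappa1 c.
  by case: (kappaP b) => [[c [-> ->]] [->]|[nb ->]] //; exists c.
have cover d : range iota d \/ range kappa d.
  case: d => [a|[b nb]]; first by left; exists a.
  right; exists b => //; case: (kappaP b) => [[c [bc _]]|[nb' ->]].
    by case: nb; exists c.
  by congr inr; exact: sval_inj.
exists (Structure (amalgam_rel N iota kappa)), iota, kappa; split; first split.
- exact: (amalgam_model hPQN mA mB eA eB).
- exact: (amalgam_embedding_l mA mB eA eB).
- exact: (amalgam_embedding_r mA mB eA eB).
- by apply/funext => c; exact: square.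
- apply/seteqP; split=> [_ [[a _ <-] [b _ /esym/meet[c [-> _]]]]|_ [_ [c _ <-] <-]].
    by exists (iota1 c) => //; exists c.
  by split; [exists (iota1 c) | exists (kappa1 c)].
- by move=> a b na nb; split; [exact: amalgam_le_lr | exact: amalgam_le_rl].
Qed.

(** * The generic model *)

Definition hereditary (T : theory) : Prop :=
  forall (A B : structure) (f : A -> B), embedding f -> model T B -> model T A.

(* Satisfied by theories axiomatised by universal sentences with at most three
   quantifiers. *)
Definition locally_axiomatised (T : theory) : Prop :=
  forall A : structure,
    (forall x y z : A, exists S : set A,
       [/\ S x, S y, S z & model T (substructure S)]) -> model T A.

Lemma T_hereditary P Q N : hereditary (T_ P Q N).
Proof.
move=> A B f [fi fr] /model_T_E[tle tll hP hQ hN].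
have le x y : @sle A x y <-> sle (f x) (f y) by apply: fr.
have ll x y : @sll A x y <-> sll (f x) (f y) by apply: fr.
apply/model_T_E; split.
- by move=> x y z; rewrite !le; exact: tle.
- by move=> x y z; rewrite !ll; exact: tll.
- move=> [] /hP /= h x; [exact/le | by rewrite le | move=> y].
  by rewrite !le => xy yx; apply: fi; exact: h.
- move=> [] /hQ /= h x; [exact/ll | by rewrite ll | move=> y].
  by rewrite !ll => xy yx; apply: fi; exact: h.
- move=> [] /hN /= h x y; [| | move=> z | move=> z]; rewrite ?le ?ll; exact: h.
Qed.

Lemma T_locally_axiomatised P Q N : locally_axiomatised (T_ P Q N).
Proof.
move=> A loc; apply/model_T_E; split.
- move=> x y z; have [S [Sx Sy Sz /model_T_E[h _ _ _ _]]] := loc x y z.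
  exact: (h (exist _ x Sx) (exist _ y Sy) (exist _ z Sz)).
- move=> x y z; have [S [Sx Sy Sz /model_T_E[_ h _ _ _]]] := loc x y z.
  exact: (h (exist _ x Sx) (exist _ y Sy) (exist _ z Sz)).
- move=> p Pp; have {}loc x y z : exists S : set A, [/\ S x, S y, S z &
      rel_property_holds (@sle (substructure S)) p].
    have [S [Sx Sy Sz /model_T_E[_ _ h _ _]]] := loc x y z.
    by exists S; split=> //; exact: h.
  case: p {Pp} loc => loc x; [| |move=> y].
  + by have [S [Sx _ _ h]] := loc x x x; exact: (h (exist _ x Sx)).
  + by have [S [Sx _ _ h]] := loc x x x; exact: (h (exist _ x Sx)).
  + have [S [Sx Sy _ h]] := loc x y y => xy yx.
    by case: (h (exist _ x Sx) (exist _ y Sy) xy yx).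
- move=> p Pp; have {}loc x y z : exists S : set A, [/\ S x, S y, S z &
      rel_property_holds (@sll (substructure S)) p].
    have [S [Sx Sy Sz /model_T_E[_ _ _ h _]]] := loc x y z.
    by exists S; split=> //; exact: h.
  case: p {Pp} loc => loc x; [| |move=> y].
  + by have [S [Sx _ _ h]] := loc x x x; exact: (h (exist _ x Sx)).
  + by have [S [Sx _ _ h]] := loc x x x; exact: (h (exist _ x Sx)).
  + have [S [Sx Sy _ h]] := loc x y y => xy yx.
    by case: (h (exist _ x Sx) (exist _ y Sy) xy yx).
- move=> p Pp; have {}loc x y z : exists S : set A, [/\ S x, S y, S z &
      condition_holds (substructure S) p].
    have [S [Sx Sy Sz /model_T_E[_ _ _ _ h]]] := loc x y z.
    by exists S; split=> //; exact: h.
  case: p {Pp} loc => loc x y; [| |move=> z|move=> z].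
  + by have [S [Sx Sy _ h]] := loc x y y; exact: (h (exist _ x Sx) (exist _ y Sy)).
  + by have [S [Sx Sy _ h]] := loc x y y; exact: (h (exist _ x Sx) (exist _ y Sy)).
  + have [S [Sx Sy Sz h]] := loc x y z.
    exact: (h (exist _ x Sx) (exist _ y Sy) (exist _ z Sz)).
  + have [S [Sx Sy Sz h]] := loc x y z.
    exact: (h (exist _ x Sx) (exist _ y Sy) (exist _ z Sz)).
Qed.

(** * Construction of the limit by stages *)

Section FraisseLimit.
Variable T : theory.
Hypotheses (her : hereditary T) (loc : locally_axiomatised T).
Hypothesis amalg : superamalgamation T.

Let rels := symbol -> nat -> nat -> Prop.
Let model_on (J : rels) (S : set nat) : Prop :=
  model T (@substructure (Structure J) S).
Let agree (S : set nat) (J J' : rels) : Prop :=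
  forall s x y, S x -> S y -> (J s x y <-> J' s x y).

(** Amalgamate over [S] the model on the numbers below [n] with the extension of [S] by [n], then
    pull the relations back along [h]. *)
Let one_point_step n (J J' : rels) (S : set nat) :
  S `<=` `I_n -> model_on J `I_n -> agree S J J' -> model_on J' (n |` S) ->
  exists K : rels, [/\ model_on K `I_n.+1, agree `I_n J K & agree (n |` S) J' K].
Proof.
move=> Sn mJ JJ' mJ'.
pose A := @substructure (Structure J) `I_n.
pose B := @substructure (Structure J') (n |` S).
pose C := @substructure (Structure J) S.
pose iota1 (c : C) : A := exist _ (sval c) (Sn _ (svalP c)).
pose kappa1 (c : C) : B := exist _ (sval c) (or_intror (svalP c)).
have eA : embedding iota1 by split=> [x y [/sval_inj]|].
have eB : embedding kappa1.
  split=> [x y [/sval_inj]//|s x y].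
  exact: JJ' (svalP x) (svalP y).
have mC : model T C by exact: her eA mJ.
have [D [iota [kappa [[mD eiota ekappa sq meet] _]]]] := amalg mJ mJ' mC eA eB.
have sqE c : iota (iota1 c) = kappa (kappa1 c) := congr1 (fun f => f c) sq.
have nB : (n |` S) n by left.
pose h (x : nat) : D :=
  if pselect (x < n) is left lt_x then iota (exist _ x lt_x) else kappa (exist _ n nB).
have hA x (lt_x : x < n) : h x = iota (exist _ x lt_x).
  by rewrite /h; case: pselect => // lt_x'; congr iota; exact: sval_inj.
have hB x (Bx : (n |` S) x) : h x = kappa (exist _ x Bx).
  case: (Bx) => [xn|Sx].
    rewrite /h; case: pselect => [lt_x|_]; first by exfalso; move: lt_x; rewrite xn ltnn.
    by congr kappa; apply: sval_inj; rewrite /= xn.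
  rewrite (hA _ (Sn _ Sx)); transitivity (kappa (kappa1 (exist _ x Sx))).
    by rewrite -sqE; congr iota; exact: sval_inj.
  by congr kappa; exact: sval_inj.
pose K : rels := fun s x y => interp s (h x) (h y).
(* The two images meet only in that of [C], so a coincidence would put [n] in [S], all of whose
   elements are below [n]. *)
have nE x : x < n -> h x <> h n.
  move=> lt_x; rewrite (hA _ lt_x) (hB _ nB) => xn.
  have : (range iota `&` range kappa) (kappa (exist _ n nB)).
    by split; [exists (exist _ x lt_x) | exists (exist _ n nB)].
  rewrite meet => -[_ [c _ <-]].
  by rewrite sqE => /ekappa.1[cn]; have /= := Sn _ (svalP c); rewrite cn ltnn.
exists K; split.
- pose hK (w : @substructure (Structure K) `I_n.+1) : D := h (sval w).
  apply: (@her _ _ hK) mD; rewrite /hK; split=> // -[x lt_x] [y lt_y] /= hxy.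
  apply: sval_inj => /=; move: (lt_x) (lt_y).
  rewrite /= !ltnS (leq_eqVlt x) (leq_eqVlt y).
  move=> /predU1P[xn|lt_xn] /predU1P[yn|lt_yn].
  + by rewrite xn yn.
  + by case: (nE _ lt_yn); rewrite -xn.
  + by case: (nE _ lt_xn); rewrite -yn.
  + by move: hxy; rewrite (hA _ lt_xn) (hA _ lt_yn) => /eiota.1[].
- by move=> s x y Ix Iy; rewrite /K (hA _ Ix) (hA _ Iy) -(eiota.2 s).
- by move=> s x y Ix Iy; rewrite /K (hB _ Ix) (hB _ Iy) -(ekappa.2 s).
Qed.

(* A task lists the points of a finite set and, for each of the two relations,
   whether the new point is related to itself and which points of the set are
   below and above it. *)
Let row := (bool * seq nat * seq nat)%type.
Let task := (seq nat * row * row)%type.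

Let task_row (t : task) (s : symbol) : row :=
  match s with Leq => t.1.2 | Ll => t.2 end.

Let task_rels (t : task) n (J : rels) : rels := fun s x y =>
  if x == n then
    is_true (if y == n then (task_row t s).1.1 else y \in (task_row t s).2)
  else if y == n then is_true (x \in (task_row t s).1.2) else J s x y.

Let task_set (t : task) : set nat := [set` t.1.1].

Let state := {nJ : nat * rels | model_on nJ.2 `I_nJ.1}.
Let ssize (S : state) : nat := (sval S).1.
Let srels (S : state) : rels := (sval S).2.

(* [logn 2] takes every value at arbitrarily late stages, so every task is
   attempted again after its points have been created. *)
Let state_step (kS : nat * state) : exists S' : state,
  [/\ ssize kS.2 <= ssize S', agree `I_(ssize kS.2) (srels kS.2) (srels S')
    & forall t : task, unpickle (logn 2 kS.1) = Some t ->
      task_set t `<=` `I_(ssize kS.2) ->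
      model_on (task_rels t (ssize kS.2) (srels kS.2)) (ssize kS.2 |` task_set t) ->
      ssize S' = (ssize kS.2).+1 /\
      agree (ssize kS.2 |` task_set t) (task_rels t (ssize kS.2) (srels kS.2))
        (srels S')].
Proof.
case: kS => k [[n J] mJ]; rewrite /ssize /srels /=.
case: (unpickle _) => [t|]; last by exists (exist _ (n, J) mJ).
have [[tn mt]|nt] := pselect (task_set t `<=` `I_n /\
    model_on (task_rels t n J) (n |` task_set t)); last first.
  by exists (exist _ (n, J) mJ); split=> // t' [<-] h1 h2; case: nt.
have JJ' : agree (task_set t) J (task_rels t n J).
  move=> s x y /tn /= xn /tn /= yn.
  by rewrite /task_rels (ltn_eqF xn) (ltn_eqF yn).
have [K [mK JK J'K]] := one_point_step tn mJ JJ' mt.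
by exists (exist _ (n.+1, K) mK); split=> //= t' [<-].
Qed.

Let next : {next : nat * state -> state | forall kS : nat * state,
  [/\ ssize kS.2 <= ssize (next kS),
      agree `I_(ssize kS.2) (srels kS.2) (srels (next kS))
    & forall t : task, unpickle (logn 2 kS.1) = Some t ->
      task_set t `<=` `I_(ssize kS.2) ->
      model_on (task_rels t (ssize kS.2) (srels kS.2)) (ssize kS.2 |` task_set t) ->
      ssize (next kS) = (ssize kS.2).+1 /\
      agree (ssize kS.2 |` task_set t) (task_rels t (ssize kS.2) (srels kS.2))
        (srels (next kS))]}.
Proof. by have [f fP] := choice state_step; exists f. Qed.

(** The condition on triples of points is vacuous. *)
Let model_on_empty : model_on (fun _ _ _ => False) `I_0.
Proof. by apply: loc => -[]. Qed.

Let stage : nat -> state :=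
  fix stage k := if k is k'.+1 then sval next (k', stage k')
    else exist _ (0, fun _ _ _ => False) model_on_empty.

Let stage_mono k l : k <= l -> ssize (stage k) <= ssize (stage l) /\
  agree `I_(ssize (stage k)) (srels (stage k)) (srels (stage l)).
Proof.
elim: l => [|l IH]; first by rewrite leqn0 => /eqP->.
rewrite leq_eqVlt => /predU1P[->//|/IH[kl agr]].
have [ll agr' _] := svalP next (l, stage l).
split=> [|s x y xk yk]; first exact: leq_trans kl ll.
rewrite agr //; apply: agr'; [exact: leq_trans xk kl | exact: leq_trans yk kl].
Qed.

Let limit_rels : rels := fun s x y => exists k,
  [/\ x < ssize (stage k), y < ssize (stage k) & srels (stage k) s x y].

Let limit_agree k : agree `I_(ssize (stage k)) (srels (stage k)) limit_rels.
Proof.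
move=> s x y xk yk; split=> [h|[l [xl yl h]]]; first by exists k.
have [kl|/ltnW lk] := leqP k l.
  exact/(stage_mono kl).2.
by apply/(stage_mono lk).2.
Qed.

(** The stages may stop growing, as when [T] has only the empty model, so the carrier is restricted
    to the numbers actually reached. *)
Let limit : structure :=
  @substructure (Structure limit_rels) [set x | exists k, x < ssize (stage k)].

Let limit_bound n (u : 'I_n -> limit) :
  exists k, forall i, sval (u i) < ssize (stage k).
Proof.
have /choice[f fP] (i : 'I_n) : exists k, sval (u i) < ssize (stage k).
  by case: (u i).
exists (\max_i f i) => i; apply: leq_trans (fP i) _.
exact: (stage_mono (leq_bigmax i)).1.
Qed.

Let limit_countable : countable_structure limit.
Proof. by apply/countable_injP; exists sval => x y _ _; exact: sval_inj. Qed.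

Let limit_model : model T limit.
Proof.
apply: loc => x y z.
have [k kP] := limit_bound (extend x (extend y (fun _ : 'I_1 => z))).
have {kP}[xk yk zk] : [/\ sval x < ssize (stage k), sval y < ssize (stage k)
    & sval z < ssize (stage k)].
  split; [exact: (kP (@Ordinal 3 0 isT)) | exact: (kP (@Ordinal 3 1 isT)) |].
  exact: (kP (@Ordinal 3 2 isT)).
exists [set w | sval w < ssize (stage k)]; split=> //.
have mk := svalP (stage k).
pose f (w : @substructure limit [set w | sval w < ssize (stage k)]) :
  @substructure (Structure (srels (stage k))) `I_(ssize (stage k)) :=
  exist _ (sval (sval w)) (svalP w).
apply: (@her _ _ f) mk; split=> [v w [/sval_inj/sval_inj]//|s v w].
exact: (iff_sym (@limit_agree k s _ _ (svalP v) (svalP w))).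
Qed.

(** The type of [b] over [w], copied onto the points of [u], is a task; a late stage that attempts
    it creates the required point. *)
Let limit_extension (B : structure) : model T B -> extension_property B limit.
Proof.
move=> mB m w u wu b.
have [[i <-]|nb] := pselect (exists i, w i = b).
  by exists (u i); exact: same_type_extend_old.
have [k0 k0P] := limit_bound u.
pose pts := [seq sval (u i) | i <- enum 'I_m].
pose mkrow s : row := (`[<interp s b b>],
  [seq x <- pts | `[<exists i, x = sval (u i) /\ interp s (w i) b>]],
  [seq x <- pts | `[<exists i, x = sval (u i) /\ interp s b (w i)>]]).
pose t : task := (pts, mkrow Leq, mkrow Ll).
have tE s : task_row t s = mkrow s by case: s.
have ptsP x : x \in pts <-> exists i, x = sval (u i).
  split=> [/mapP[i _ ->]|[i ->]]; first by exists i.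
  by apply/mapP; exists i => //; rewrite mem_enum.
have [we wr] := wu.
have uE i j : sval (u i) = sval (u j) <-> w i = w j.
  by rewrite we; split=> [/sval_inj|->].
(* The odd factor keeps the 2-adic valuation equal to [pickle t] and makes [k] at least [k0], so the
   points of [u] exist at stage [k]. *)
pose k := 2 ^ pickle t * k0.*2.+1.
have k0k : k0 <= k.
  rewrite /k; apply: leq_trans (leq_pmull _ _); last by rewrite expn_gt0.
  by rewrite -addnn ltnW // ltnS leq_addr.
have kt : unpickle (logn 2 k) = Some t.
  rewrite /k lognM ?expn_gt0 // pfactorK // logn_coprime ?addn0 ?pickleK //.
  by rewrite coprime2n /= odd_double.
set n := ssize (stage k); set J := srels (stage k).
have un i : sval (u i) < n.
  exact: leq_trans (k0P i) (stage_mono k0k).1.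
have tn : task_set t `<=` `I_n by move=> x /ptsP[i ->]; exact: un.
(* [g] will embed the structure prescribed by the task into [B], which makes it a model by heredity.
   The value [b] off the points of [u] includes the one at [n]. *)
have /choice[g gP] x : exists y : B,
    (x = n -> y = b) /\ forall i, x = sval (u i) -> y = w i.
  have [[i ->]|nx] := pselect (exists i, x = sval (u i)).
    exists (w i); split=> [uin|j /uE //].
    by have := un i; rewrite uin ltnn.
  by exists b; split=> // i xi; case: nx; exists i.
have gn : g n = b := (gP n).1 erefl.
have gu i : g (sval (u i)) = w i := (gP _).2 i erefl.
have JE s x y : (n |` task_set t) x -> (n |` task_set t) y ->
    task_rels t n J s x y <-> interp s (g x) (g y).
  have un' i : (sval (u i) == n) = false by exact: ltn_eqF (un i).
  have row1 i : sval (u i) \in (task_row t s).1.2 <-> interp s (w i) b.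
    rewrite tE mem_filter; split=> [/andP[/asboolP[j [/uE -> //]]]|h].
    by apply/andP; split; [apply/asboolP; exists i | apply/ptsP; exists i].
  have row2 i : sval (u i) \in (task_row t s).2 <-> interp s b (w i).
    rewrite tE mem_filter; split=> [/andP[/asboolP[j [/uE -> //]]]|h].
    by apply/andP; split; [apply/asboolP; exists i | apply/ptsP; exists i].
  rewrite /task_rels => -[->|/ptsP[i ->]] [->|/ptsP[j ->]].
  - by rewrite !eqxx gn tE; split=> /asboolP.
  - by rewrite eqxx un' gn gu.
  - by rewrite eqxx un' gn gu.
  - by rewrite !un' !gu wr; exact: (@limit_agree k s _ _ (un i) (un j)).
have mt : model_on (task_rels t n J) (n |` task_set t).
  pose h (z : @substructure (Structure (task_rels t n J)) (n |` task_set t)) : B :=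
    g (sval z).
  apply: (@her _ _ h) mB; split=> [[x dx] [y dy]|s [x dx] [y dy]]; last exact: JE.
  rewrite /h /= => gxy; apply: sval_inj => /=; move: gxy.
  case: dx => [->|/ptsP[i ->]]; case: dy => [->|/ptsP[j ->]] //; rewrite ?gn ?gu.
  - by move=> bj; case: nb; exists j.
  - by move=> ib; case: nb; exists i.
  - by move=> /uE.
(* The new point is [n] itself, first present at stage [k.+1]. *)
have [_ _ /(_ t kt tn mt)[/= szk agr]] := svalP next (k, stage k).
have ltn' : n < ssize (stage k.+1) by rewrite /= szk.
exists (exist _ n (ex_intro _ k.+1 ltn')).
pose ux := extend (exist _ n (ex_intro _ k.+1 ltn') : limit) u.
have uxS i : (n |` task_set t) (sval (ux i)).
  case: (ord_succP i) => [|j]; first by left.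
  by rewrite /ux extend_lift; right; apply/ptsP; exists j.
have gux i : g (sval (ux i)) = extend b w i.
  by case: (ord_succP i) => [|j]; rewrite /ux ?extend_lift.
have uxk i : sval (ux i) < ssize (stage k.+1).
  case: (uxS i) => [->//|/tn /= h]; exact: leq_trans h (ltnW ltn').
split=> [i j|s i j].
  rewrite -/ux; split; last by rewrite -!gux => ->.
  case: (ord_succP i) => [|i']; case: (ord_succP j) => [|j'] //;
    rewrite /ux ?extend_lift ?extend0.
  - by move=> bj; case: nb; exists j'.
  - by move=> ib; case: nb; exists i'.
  - by move=> /we.
rewrite -/ux -!gux -(JE s _ _ (uxS i) (uxS j)) agr //.
exact: (@limit_agree k.+1 s _ _ (uxk i) (uxk j)).
Qed.

Lemma fraisse_limit_exists : exists M : structure,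
  [/\ countable_structure M, model T M &
      forall B : structure, model T B -> extension_property B M].
Proof. by exists limit. Qed.

End FraisseLimit.

(** * Consequences of the extension property over all models *)

Section ExtensiveModel.
Variables (T : theory) (M : structure).
Hypotheses (her : hereditary T) (cM : countable_structure M) (mM : model T M).
Hypothesis extM : forall B : structure, model T B -> extension_property B M.

(** Starting from the empty tuple, each coordinate is one use of the extension property. *)
Lemma extensive_realises (A : structure) : model T A ->
  forall n (u : 'I_n -> A), exists v : 'I_n -> M, same_type u v.
Proof.
move=> mA; elim=> [|n IH] u; first by exists (@no_var M); split=> [[]|s []].
have [v uv] := IH (u \o lift ord0); have [b] := extM mA uv (u ord0).
by rewrite extend_eta => ubv; exists (extend b v).
Qed.

Lemma extensive_age : age M = finite_models T.
Proof.
apply/seteqP; split=> A [fA]; first by case=> f ef; split=> //; exact: her ef mM.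
move=> mA; split=> //; have [n [u uT]] := finite_enum fA.
have [v [e r]] := extensive_realises mA u.
(* One index chosen for each point turns the realising tuple [v] into a map on [A]. *)
have /choice[i iP] (a : A) : exists i, u i = a.
  by have [i _ ia] : range u a by [rewrite uT]; exists i.
exists (v \o i); split=> [x y /e|s x y /=]; first by rewrite !iP.
by rewrite -r !iP.
Qed.

Lemma extensive_fraisse : fraisse_limit (finite_models T) M.
Proof.
by split; [| exact: extensive_age | exact: extension_ultrahomogeneous (extM mM)].
Qed.

Lemma extensive_model_completion : model_completion T (Th M).
Proof.
have qe := extension_qe cM (extM mM).
split=> [A mA phi Tphi|A mA|A B1 B2 _ m1 m2 f1 f2 e1 e2 n phi v].
- by apply: mA; exact: mM.
- exact: embed_in_Th_model (extensive_realises mA).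
- exact: qe_diagram_complete qe m1 m2 e1 e2.
Qed.

End ExtensiveModel.

Theorem theorem3p2 (P Q : set rel_property) (N : set condition)
    (hPQN : (N CondA1 /\ N CondA2)
         \/ (~ N CondA1 /\ ~ N CondA2)
         \/ (N CondF /\ (P Antisym \/ Q Antirefl \/ ~ Q Antisym))) :
  superamalgamation (T_ P Q N) /\
  exists M : structure,
    [/\ fraisse_limit (finite_models (T_ P Q N)) M,
        omega_categorical (Th M),
        quantifier_elimination (Th M)
      & model_completion (T_ P Q N) (Th M)].
Proof.
have sap := T_superamalgamation hPQN; split=> //.
have her := @T_hereditary P Q N.
have [M [cM mM extM]] :=
  fraisse_limit_exists her (@T_locally_axiomatised P Q N) sap.
have qe := extension_qe cM (extM _ mM).
exists M; split=> //.
- exact: extensive_fraisse.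
- exact: qe_omega_categorical.
- exact: extensive_model_completion.
Qed.
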